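(* Let $x\in\mathcal S\cdot\mathcal Y$ and let $\mathbf X\in\mathbb R^{q\times s}$ be its associated matrix of coefficients. Let $1\le\hat s\le s$. Then a best-approximating $\hat s$-dimensional subspace $\hat{\mathcal S}\subset\mathcal S$, in the sense that $\|x-\Pi_{\hat{\mathcal S}\cdot\mathcal Y}x\|_{\mathcal S\cdot\mathcal Y}$ is minimal over all subspaces of $\mathcal S$ of dimension $\hat s$, is given by $\hat{\mathcal S}=\operatorname{span}\{\hat\psi_j\}_{j=1,\dots,\hat s}$, where $$\begin{bmatrix}\hat\psi_1\\ \hat\psi_2\\ \vdots\\ \hat\psi_{\hat s}\end{bmatrix}=U_{\hat s}^{\mathsf T}\,\mathbf L_{\mathcal S}^{-1}\begin{bmatrix}\psi_1\\ \psi_2\\ \vdots\\ \psi_s\end{bmatrix}$$ and $U_{\hat s}\in\mathbb R^{s\times\hat s}$ is the matrix of the $\hat s$ leading right singular vectors of the matrix $\mathbf L_{\mathcal Y}^{\mathsf T}\mathbf X\mathbf L_{\mathcal S}$.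
   Context: Let $T>0$, let $(0,T)$ be a time interval and $\Omega$ a spatial domain; all functions are real-valued. Let $\mathcal S=\operatorname{span}\{\psi_1,\dots,\psi_s\}\subset L^2(0,T)$ and $\mathcal Y=\operatorname{span}\{\nu_1,\dots,\nu_q\}\subset L^2(\Omega)$ be subspaces of dimension $s$ and $q$, respectively (so the $\psi_j$ and the $\nu_i$ are bases). For subspaces $\mathcal S'\subset L^2(0,T)$ and $\mathcal Y'\subset L^2(\Omega)$, $\mathcal S'\cdot\mathcal Y'\subset L^2(0,T;L^2(\Omega))$ denotes the linear span of the products $\nu\psi$, $(\nu\psi)(\xi,\tau)=\nu(\xi)\psi(\tau)$, with $\nu\in\mathcal Y'$, $\psi\in\mathcal S'$. Every $x\in\mathcal S\cdot\mathcal Y$ is written uniquely as $x=\sum_{j=1}^s\sum_{i=1}^q\mathbf x_{i\cdot j}\,\nu_i\psi_j$, and its associated matrix of coefficients is $\mathbf X=[\mathbf x_{i\cdot j}]_{i=1,\dots,q}^{j=1,\dots,s}\in\mathbb R^{q\times s}$ ($i$ is the row index, $j$ the column index). The norm is $\|x\|_{\mathcal S\cdot\mathcal Y}^2=\int_0^T\int_\Omega x(\xi,\tau)^2\,\mathrm d\xi\,\mathrm d\tau$, and $\Pi_{\hat{\mathcal S}\cdot\mathcal Y}$ denotes the orthogonal projection onto $\hat{\mathcal S}\cdot\mathcal Y$ with respect to the corresponding space-time $L^2$ inner product. The mass matrices are $\mathbf M_{\mathcal Y}=[(\nu_i,\nu_j)_{L^2(\Omega)}]_{i,j=1}^q$ and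 $\mathbf M_{\mathcal S}=[(\psi_i,\psi_j)_{L^2(0,T)}]_{i,j=1}^s$, and they are given in factored form $\mathbf M_{\mathcal Y}=\mathbf L_{\mathcal Y}\mathbf L_{\mathcal Y}^{\mathsf T}$, $\mathbf M_{\mathcal S}=\mathbf L_{\mathcal S}\mathbf L_{\mathcal S}^{\mathsf T}$ with square (hence invertible) real matrices $\mathbf L_{\mathcal Y}$, $\mathbf L_{\mathcal S}$ (e.g. Cholesky factors). ''The $\hat s$ leading right singular vectors'' means the (orthonormal) right singular vectors belonging to the $\hat s$ largest singular values, counted with multiplicity and with zero singular values included if necessary, in a singular value decomposition with a full orthonormal set of $s$ right singular vectors. *)

(* Defs.v *)
From HB Require Import structures.
From mathcomp Require Import all_boot all_order all_algebra.
From mathcomp Require Import all_classical all_reals all_analysis.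

Set Implicit Arguments.
Unset Strict Implicit.
Unset Printing Implicit Defensive.

Import Order.TTheory GRing.Theory Num.Theory.
Import numFieldNormedType.Exports.

Local Open Scope classical_set_scope.
Local Open Scope ring_scope.

(* Elements of L^2(mu) are handled through representatives: functions in
   [Lfun mu 2%:E], with every identity between them read mu-almost everywhere.
   A subspace of L^2(mu) is accordingly a set of representatives which is
   saturated with respect to equality almost everywhere. *)
Section L2.
Context {d : measure_display} {X : measurableType d} {R : realType}.
Variable mu : {measure set X -> \bar R}.
Implicit Types (f g x : X -> R) (A V W : set (X -> R)).

Definition L2dot f g : R := \int[mu]_z (f z * g z).

Definition L2norm f : R := Num.sqrt (L2dot f f).

Definition lincomb n (c : 'I_n -> R) (f : 'I_n -> X -> R) : X -> R :=
  fun z => \sum_(i < n) c i * f i z.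

Definition L2span A : set (X -> R) :=
  [set g | g \in Lfun mu 2%:E /\
     exists n (c : 'I_n -> R) (f : 'I_n -> X -> R),
       (forall i, A (f i)) /\ g = lincomb c f %[ae mu]].

Definition L2free n (f : 'I_n -> X -> R) : Prop :=
  forall c : 'I_n -> R, lincomb c f = cst 0 %[ae mu] -> forall i, c i = 0.

Definition L2basis n (f : 'I_n -> X -> R) V : Prop :=
  [/\ forall i, f i \in Lfun mu 2%:E, L2free f & V = L2span (range f)].

Definition L2subspace_dim V n : Prop :=
  exists f : 'I_n -> X -> R, L2basis f V.

Definition is_orth_proj V x p : Prop :=
  V p /\ forall v, V v -> L2dot (x \- p) v = 0.

(* The orthogonal projection of x onto V, unique up to equality almost
   everywhere; the default value 0 is only taken when there is none, which
   does not happen when V is a finite-dimensional subspace and x is in L^2. *)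
Definition orth_proj V x : X -> R := xget (cst 0) [set p | is_orth_proj V x p].

Definition mass_mx n (f : 'I_n -> X -> R) : 'M[R]_n :=
  \matrix_(i, j) L2dot (f i) (f j).

End L2.

Section time.
Context {R : realType}.
Variable T : R.

Let itv0T : set (measurableTypeR R) := `]0, T[.

Fact measurable_itv0T : measurable itv0T.
Proof. exact: measurable_itv. Qed.

Fact itv0T_fin : (lebesgue_measure itv0T < +oo)%E.
Proof.
rewrite /itv0T lebesgue_measure_itv.
by case: ifP => _ //=; rewrite -EFinD ltry.
Qed.

(* L^2(0,T) is L^2 of this measure on the real line. *)
Definition time_measure : {finite_measure set measurableTypeR R -> \bar R} :=
  mfrestr measurable_itv0T itv0T_fin.

End time.

Section spacetime.
Context {d : measure_display} {Omega : measurableType d} {R : realType}.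
Variables (mu : {sigma_finite_measure set Omega -> \bar R}) (T : R).

(* The spatial domain is a sigma-finite measure space, such as a measurable
   subset of R^n with Lebesgue measure. The space-time integral is taken with
   respect to the product measure; by Fubini it is the iterated one. *)
Definition spacetime_measure :
    {measure set (Omega * measurableTypeR R) -> \bar R} :=
  (mu \x time_measure T)%E.

Definition tensor (nu : Omega -> R) (psi : R -> R) :
    Omega * measurableTypeR R -> R :=
  fun z => nu z.1 * psi z.2.

Definition prod_subspace (S : set (R -> R)) (Y : set (Omega -> R)) :
    set (Omega * measurableTypeR R -> R) :=
  L2span spacetime_measure
    [set f | exists nu psi, [/\ Y nu, S psi & f = tensor nu psi]].

End spacetime.

Section svd.
Context {R : realType}.

(* A = P Sigma Q^T, with Sigma the q x s rectangular diagonal matrix of the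
   singular values in nonincreasing order; the entries of sigma of index at
   least minn q s play no role. *)
Definition is_svd q s (A : 'M[R]_(q, s))
    (P : 'M[R]_q) (sigma : nat -> R) (Q : 'M[R]_s) : Prop :=
  [/\ P^T *m P = 1%:M, Q^T *m Q = 1%:M, forall k, 0 <= sigma k,
      nonincreasing_seq sigma
    & A = P *m (\matrix_(i < q, j < s) (sigma i *+ (i == j :> nat))) *m Q^T].

Definition leading_right_singular_vectors q s r (hr : (r <= s)%N)
    (A : 'M[R]_(q, s)) (U : 'M[R]_(s, r)) : Prop :=
  exists P sigma Q, is_svd A P sigma Q /\ U = colsub (widen_ord hr) Q.

End svd.

(* Main.v *)
Require Import Defs.
From mathcomp Require Import all_boot all_order all_algebra.
From mathcomp Require Import all_classical all_reals all_analysis.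
From mathcomp Require Import measurable_realfun.

(** The problem is a Ky Fan maximisation in disguise. Multiplying coefficient
    matrices by L_Y^T on the left and by L_S on the right passes to orthonormal
    bases of Y and S: the space-time inner product becomes the Frobenius inner
    product ([dot_tensor_comb]), and x becomes A = L_Y^T X L_S. If a subspace W
    of S has a basis with coefficient matrix C, the elements of W . Y become the
    matrices whose rows lie in the row space of C L_S ([prod_subspaceP]).
    Projecting x onto W . Y therefore means projecting every row of A onto that
    row space: with E the orthogonal projector onto it, the squared error is
    \tr (A A^T) - \tr (A E A^T) ([proj_error]).

    As W varies, E is an orthogonal projector of rank shat, and minimising the
    error amounts to maximising the energy \tr (A E A^T). In a basis of right
    singular vectors this energy is a sum of the squared singular values with
    weights the diagonal entries of E, which lie in [0, 1] and add up to shat.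
    Such a sum is at most the sum of the shat largest squared singular values
    ([energy_le_leading]), and E = U U^T attains it. The proposed psihat have
    coefficient matrix U^T L_S^-1, that is U^T in orthonormal coordinates, so
    their projector is exactly U U^T.

    Elements of L^2 are representatives, hence each identity between functions
    is carried along almost everywhere; it passes to products on space-time by
    [ae_eq_tensor]. *)

Set Implicit Arguments.
Unset Strict Implicit.
Unset Printing Implicit Defensive.

Import Order.TTheory GRing.Theory Num.Theory.
Import numFieldNormedType.Exports.

Local Open Scope classical_set_scope.
Local Open Scope ring_scope.

(** * Orthogonal projectors onto row spaces *)

Section Frobenius.
Variable R : realFieldType.

Lemma mxtrace_mul_tr m n (A B : 'M[R]_(m, n)) :
  \tr (A *m B^T) = \sum_i \sum_j A i j * B i j.
Proof.
rewrite /mxtrace; apply: eq_bigr => i _; rewrite mxE.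
by apply: eq_bigr => j _; rewrite mxE.
Qed.

Lemma mxtrace_mul_tr_eq0 m n (A : 'M[R]_(m, n)) : \tr (A *m A^T) = 0 -> A = 0.
Proof.
rewrite mxtrace_mul_tr => /eqP; rewrite psumr_eq0; last first.
  by move=> i _; apply: sumr_ge0 => j _; rewrite -expr2 sqr_ge0.
move/allP => A0; apply/matrixP => i j; rewrite mxE.
have := A0 i (mem_index_enum _) => /=.
rewrite psumr_eq0; last by move=> k _; rewrite -expr2 sqr_ge0.
move/allP/(_ j (mem_index_enum _)) => /=.
by rewrite mulf_eq0 orbb => /eqP.
Qed.

(** A Gram matrix of independent rows is definite: v C C^T v^T is the square
    norm of v C. *)
Lemma gram_unitmx r s (C : 'M[R]_(r, s)) :
  row_free C -> C *m C^T \in unitmx.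
Proof.
move=> Cfree; rewrite -row_free_unit -kermx_eq0; apply/rowV0P => v /sub_kermxP.
rewrite mulmxA => vCC0; apply/eqP; rewrite -(mulmx_free_eq0 _ Cfree); apply/eqP.
by apply: mxtrace_mul_tr_eq0; rewrite trmx_mul mulmxA vCC0 mul0mx mxtrace0.
Qed.

(** For C with independent rows, the orthogonal projector onto its row space,
    acting on row vectors; the Gram matrix spares an orthonormalisation. *)
Definition row_proj r s (C : 'M[R]_(r, s)) : 'M[R]_s :=
  C^T *m invmx (C *m C^T) *m C.

Lemma row_proj_tr r s (C : 'M[R]_(r, s)) : (row_proj C)^T = row_proj C.
Proof.
by rewrite /row_proj !trmx_mul trmx_inv trmx_mul !trmxK mulmxA.
Qed.

Lemma mul_row_proj r s (C : 'M[R]_(r, s)) :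
  row_free C -> C *m row_proj C = C.
Proof.
by move=> /gram_unitmx CCu; rewrite /row_proj !mulmxA mulmxV // mul1mx.
Qed.

Lemma row_proj_idem r s (C : 'M[R]_(r, s)) :
  row_free C -> row_proj C *m row_proj C = row_proj C.
Proof. by move=> Cfree; rewrite {1}/row_proj -mulmxA mul_row_proj. Qed.

Lemma mxtrace_row_proj r s (C : 'M[R]_(r, s)) :
  row_free C -> \tr (row_proj C) = r%:R.
Proof.
move=> /gram_unitmx CCu; rewrite /row_proj -mulmxA mxtrace_mulC -mulmxA.
by rewrite mulVmx // mxtrace1.
Qed.

Lemma diag_projector01 n (P : 'M[R]_n) k :
  P^T = P -> P *m P = P -> 0 <= P k k <= 1.
Proof.
move=> Psym Pid.
have Pkk : P k k = \sum_l P k l ^+ 2.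
  rewrite -{1}Pid mxE; apply: eq_bigr => l _.
  by rewrite -{2}Psym mxE expr2.
have Pkk0 : 0 <= P k k by rewrite Pkk; apply: sumr_ge0 => l _; exact: sqr_ge0.
have : P k k ^+ 2 <= P k k.
  rewrite {2}Pkk (bigD1 k) //= lerDl.
  by apply: sumr_ge0 => l _; exact: sqr_ge0.
rewrite Pkk0 /=; have [//|Pgt1] := leP (P k k) 1.
by rewrite expr2 ger_pMr ?(lt_trans ltr01) // leNgt Pgt1.
Qed.

(** Replacing lam k by lam k - lam r lowers both sides equally, since t and the
    indicator of k < r have the same sum; then the comparison holds term by
    term. *)
Lemma weighted_sum_le_head s r (lam : nat -> R) (t : 'I_s -> R) :
  (r <= s)%N -> (forall i j, (i <= j)%N -> lam j <= lam i) ->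
  (forall k, 0 <= t k <= 1) -> \sum_k t k = r%:R ->
  \sum_(k < s) lam k * t k <= \sum_(k < s) lam k * (k < r)%N%:R.
Proof.
move=> rs lam_dec t01 sum_t.
have sum_head : \sum_(k < s) (k < r)%N%:R = r%:R :> R.
  rewrite (eq_bigr (fun k : 'I_s => if (k < r)%N then 1 else 0)) => [|k _].
    by rewrite -big_mkcond -(big_ord_widen s (fun=> 1)) // sumr_const card_ord.
  by case: ltnP.
rewrite -subr_ge0 -sumrB.
rewrite [leRHS](_ : _ =
  \sum_(k < s) (lam k - lam r) * ((k < r)%N%:R - t k)); last first.
  under [RHS]eq_bigr do rewrite mulrBl !mulrBr.
  by rewrite [RHS]sumrB [X in _ - X]sumrB -!mulr_sumr sum_head sum_t subrr subr0.
apply: sumr_ge0 => k _; have /andP[t0 t1] := t01 k.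
case: ltnP => kr.
  by rewrite mulr_ge0 // subr_ge0 // lam_dec // ltnW.
by rewrite mulr_le0 // ?sub0r ?oppr_le0 // subr_le0 lam_dec.
Qed.

End Frobenius.

Section projection_residual.
Context {R : realFieldType}.

Lemma mul_sub_row_proj q r s (A : 'M[R]_(q, s)) (C : 'M[R]_(r, s)) :
  row_free C -> (A - A *m row_proj C) *m C^T = 0.
Proof.
move=> Cfree; rewrite mulmxBl -mulmxA -[row_proj C]row_proj_tr -trmx_mul.
by rewrite mul_row_proj // subrr.
Qed.

(** Orthogonality to all B' C forces A - B C to vanish on the row space of C,
    so that B C = A (row_proj C); the rest is Pythagoras. *)
Lemma orth_residual_norm q r s (A : 'M[R]_(q, s)) (B : 'M[R]_(q, r))
    (C : 'M[R]_(r, s)) :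
  row_free C -> (forall B', \tr ((A - B *m C) *m (B' *m C)^T) = 0) ->
  \tr ((A - B *m C) *m (A - B *m C)^T) =
  \tr (A *m A^T) - \tr (A *m row_proj C *m A^T).
Proof.
move=> Cfree orth.
have resC : (A - B *m C) *m C^T = 0.
  apply: mxtrace_mul_tr_eq0; rewrite -[RHS](orth ((A - B *m C) *m C^T)).
  by rewrite trmx_mul trmxK [in RHS]trmx_mul !trmx_mul trmxK !mulmxA.
have -> : B *m C = A *m row_proj C.
  have : (A - B *m C) *m row_proj C = 0.
    by rewrite /row_proj !mulmxA resC !mul0mx.
  rewrite mulmxBl -mulmxA mul_row_proj // => /eqP.
  by rewrite subr_eq0 => /eqP.
rewrite [X in _ *m X]linearB /= mulmxBr trmx_mul row_proj_tr.
rewrite [X in _ - X](_ : _ = 0); last first.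
  by rewrite mulmxA mulmxBl -(mulmxA A) row_proj_idem // subrr mul0mx.
by rewrite subr0 mulmxBl linearB.
Qed.

End projection_residual.

(** * Singular values and the Ky Fan inequality *)

Section KyFan.
Context {R : realType}.

(** The eigenvalues of A^T A, in nonincreasing order and padded with zeros, for
    A with q rows and singular values sigma. *)
Definition sq_sing_val (q : nat) (sigma : nat -> R) (k : nat) : R :=
  sigma k ^+ 2 *+ (k < q).

Lemma sq_sing_val_dec q sigma i j :
  (forall k, 0 <= sigma k) -> nonincreasing_seq sigma -> (i <= j)%N ->
  sq_sing_val q sigma j <= sq_sing_val q sigma i.
Proof.
move=> sigma0 sigma_dec ij; rewrite /sq_sing_val.
case: (ltnP j q) => [jq|_]; last by rewrite mulrn_wge0 // sqr_ge0.
by rewrite (leq_ltn_trans ij jq) !mulr1n ler_sqr ?nnegrE // sigma_dec.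
Qed.

Lemma svd_energy q s (A : 'M[R]_(q, s)) P sigma Q (E : 'M[R]_s) :
  is_svd A P sigma Q ->
  \tr (A *m E *m A^T) =
  \sum_(k < s) sq_sing_val q sigma k * (Q^T *m E *m Q) k k.
Proof.
case=> PP _ _ _ ->; set D := \matrix_(i, j) _.
have DD : D^T *m D = diag_mx (\row_k sq_sing_val q sigma k).
  apply/matrixP => i j; rewrite !mxE /sq_sing_val.
  under eq_bigr do rewrite !mxE.
  have [iq|qi] := ltnP i q.
    rewrite (bigD1 (Ordinal iq)) //= big1 ?addr0 ?eqxx => [|k /negPf].
      by rewrite -val_eqE; case: eqP; rewrite ?mulr1n ?mulr0n ?mulr0 ?expr2.
    by rewrite -val_eqE /= => ->; rewrite mul0r.
  rewrite mulr0n mul0rn big1 // => k _.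
  by rewrite ltn_eqF ?mul0r // (leq_trans (ltn_ord k)).
have -> : P *m D *m Q^T *m E *m (P *m D *m Q^T)^T =
    P *m (D *m (Q^T *m E *m Q) *m D^T *m P^T).
  by rewrite !trmx_mul trmxK !mulmxA.
rewrite mxtrace_mulC -!mulmxA PP mulmx1 mxtrace_mulC -!mulmxA DD.
rewrite !mulmxA /mxtrace; apply: eq_bigr => k _.
rewrite mul_mx_diag [LHS]mxE mulrC !mxE; congr (_ * _).
Qed.

(** Ky Fan: by [svd_energy] the left-hand side weighs the squared singular values
    by the diagonal of Q^T E Q, whose entries lie in [0, 1] and add up to r; on
    the right-hand side the first r weights are 1 and the others 0. *)
Lemma energy_le_leading q s r (hr : (r <= s)%N) (A : 'M[R]_(q, s))
    (U : 'M[R]_(s, r)) (E : 'M[R]_s) :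
  leading_right_singular_vectors hr A U ->
  E^T = E -> E *m E = E -> \tr E = r%:R ->
  \tr (A *m E *m A^T) <= \tr (A *m (U *m U^T) *m A^T).
Proof.
case=> P [sigma [Q [svdA ->]]] Esym Eid trE.
have [_ QQ sigma0 sigma_dec _] := svdA.
have QQ' : Q *m Q^T = 1%:M by exact: mulmx1C.
rewrite !(svd_energy _ svdA).
rewrite [leRHS](_ : _ =
  \sum_(k < s) sq_sing_val q sigma k * (k < r)%N%:R); last first.
  apply: eq_bigr => k _; congr (_ * _).
  set V := colsub _ Q.
  have -> : Q^T *m (V *m V^T) *m Q = (Q^T *m V) *m (Q^T *m V)^T.
    by rewrite trmx_mul trmxK !mulmxA.
  have -> : Q^T *m V = colsub (widen_ord hr) 1%:M by rewrite mulmx_colsub QQ.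
  rewrite mxE; have [kr|rk] := ltnP k r.
    rewrite (bigD1 (Ordinal kr)) //= big1 ?addr0 => [|j /negPf jk].
      by rewrite !mxE -val_eqE /= eqxx mulr1.
    by rewrite !mxE -val_eqE /= eq_sym -val_eqE /= in jk *; rewrite jk mul0r.
  rewrite big1 // => j _; rewrite !mxE -val_eqE /= gtn_eqF ?mul0r //.
  exact: leq_trans (ltn_ord j) rk.
apply: weighted_sum_le_head => //.
- by move=> i j; exact: sq_sing_val_dec.
- move=> k; apply: diag_projector01.
    by rewrite !trmx_mul trmxK Esym mulmxA.
  by rewrite !mulmxA -(mulmxA _ Q) QQ' mulmx1 -(mulmxA _ E E) Eid.
- by rewrite -/(mxtrace _) mxtrace_mulC mulmxA QQ' mul1mx.
Qed.

Lemma leading_right_singular_vectors_orth q s r (hr : (r <= s)%N)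
    (A : 'M[R]_(q, s)) (U : 'M[R]_(s, r)) :
  leading_right_singular_vectors hr A U -> U^T *m U = 1%:M.
Proof.
case=> P [sigma [Q [[_ QQ _ _ _] ->]]].
set f := widen_ord hr; have -> : (colsub f Q)^T = rowsub f Q^T.
  by apply/matrixP => i j; rewrite !mxE.
rewrite mulmx_colsub mul_rowsub_mx QQ.
by apply/matrixP => i j; rewrite !mxE -!val_eqE.
Qed.

End KyFan.

(** * Finite families in L^2 *)

Section L2_theory.
Context {d : measure_display} {X : measurableType d} {R : realType}.
Variable mu : {measure set X -> \bar R}.
Implicit Types (f g : X -> R).
Local Notation L2 := (Lfun mu 2%:E).

Lemma Lfun2_measurable f : f \in L2 -> measurable_fun setT f.
Proof. by rewrite inE => /andP[]; rewrite inE. Qed.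

Lemma Lfun2P f : f \in L2 <->
  measurable_fun setT f /\ (\int[mu]_z ((f z) ^+ 2)%:E < +oo)%E.
Proof.
split=> [fL2|[mf fi]].
  split; first exact: Lfun2_measurable.
  have /integrableP[_] := Lfun2_integrable_sqr fL2.
  under eq_integral do rewrite gee0_abs ?lee_fin ?sqr_ge0 //.
  by [].
rewrite inE; apply/andP; split; rewrite inE //= /finite_norm unlock /Lnorm.
rewrite poweR_lty //=.
under eq_integral do rewrite powR_mulrn // real_normK ?num_real //.
exact: fi.
Qed.

Lemma Lfun2_sum I (r : seq I) (F : I -> X -> R) :
  (forall i, F i \in L2) -> (fun z => \sum_(i <- r) F i z) \in L2.
Proof.
have [L20 L2lin] := Lfun_submod_closed mu (lee1n 2).
move=> FL2; rewrite -fct_sumE; elim/big_ind: _ => // f g fL2 gL2.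
by rewrite -[f]scale1r; exact: L2lin.
Qed.

Lemma Lfun2Z a f : f \in L2 -> (fun z => a * f z) \in L2.
Proof.
have [L20 L2lin] := Lfun_submod_closed mu (lee1n 2).
move=> fL2; have := L2lin a _ _ fL2 L20.
by rewrite addr0.
Qed.

Lemma Lfun2_lincomb n (c : 'I_n -> R) (f : 'I_n -> X -> R) :
  (forall i, f i \in L2) -> lincomb c f \in L2.
Proof. by move=> fL2; apply: Lfun2_sum => i; exact: Lfun2Z. Qed.

Lemma Lfun2B f g : f \in L2 -> g \in L2 -> f \- g \in L2.
Proof.
have [L20 L2lin] := Lfun_submod_closed mu (lee1n 2).
move=> fL2 gL2; have := L2lin (-1) _ _ gL2 fL2.
by rewrite scaleN1r addrC.
Qed.

Lemma integrable_mul_Lfun2 f g : f \in L2 -> g \in L2 ->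
  mu.-integrable setT (fun z => (f z * g z)%:E).
Proof. by move=> fL2 gL2; apply/Lfun1_integrable; exact: Lfun2_mul_Lfun1. Qed.

Lemma L2dotC f g : L2dot mu f g = L2dot mu g f.
Proof. by apply: eq_Rintegral => z _; rewrite mulrC. Qed.

Lemma L2dotZl a f g : f \in L2 -> g \in L2 ->
  L2dot mu (fun z => a * f z) g = a * L2dot mu f g.
Proof.
move=> fL2 gL2; rewrite /L2dot -RintegralZl //; last exact: integrable_mul_Lfun2.
by apply: eq_Rintegral => z _; rewrite mulrA.
Qed.

Lemma L2dot_suml I (r : seq I) (F : I -> X -> R) g :
  (forall i, F i \in L2) -> g \in L2 ->
  L2dot mu (fun z => \sum_(i <- r) F i z) g = \sum_(i <- r) L2dot mu (F i) g.
Proof.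
move=> FL2 gL2; elim: r => [|i r IHr].
  rewrite big_nil /L2dot (@eq_Rintegral _ _ _ _ _ (cst 0)) => [|z _].
    by rewrite Rintegral_cst // mul0r.
  by rewrite big_nil mul0r.
rewrite big_cons -IHr /L2dot -RintegralD //.
- by apply: eq_Rintegral => z _; rewrite big_cons mulrDl.
- exact: integrable_mul_Lfun2.
- by apply: integrable_mul_Lfun2 => //; exact: Lfun2_sum.
Qed.

Lemma L2dot_lincombl n (c : 'I_n -> R) (f : 'I_n -> X -> R) g :
  (forall i, f i \in L2) -> g \in L2 ->
  L2dot mu (lincomb c f) g = \sum_i c i * L2dot mu (f i) g.
Proof.
move=> fL2 gL2; rewrite L2dot_suml => [|i|//]; last exact: Lfun2Z.
by apply: eq_bigr => i _; exact: L2dotZl.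
Qed.

Lemma ae_eq_L2dot f f' g g' :
  f \in L2 -> f' \in L2 -> g \in L2 -> g' \in L2 ->
  f = f' %[ae mu] -> g = g' %[ae mu] -> L2dot mu f g = L2dot mu f' g'.
Proof.
move=> fL2 f'L2 gL2 g'L2 ff' gg'; rewrite /L2dot /Rintegral; congr fine.
apply: ae_eq_integral => //.
- by have /integrableP[] := integrable_mul_Lfun2 fL2 gL2.
- by have /integrableP[] := integrable_mul_Lfun2 f'L2 g'L2.
- by apply: filterS2 ff' gg' => z /(_ I) + /(_ I) + _ => -> ->.
Qed.

Lemma L2dot_eq0 f : f \in L2 -> L2dot mu f f = 0 -> f = cst 0 %[ae mu].
Proof.
move=> fL2 f0; have ff := integrable_mul_Lfun2 fL2 fL2.
have /integrableP[mff _] := ff.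
have : (\int[mu]_z `|(f z * f z)%:E| = 0)%E.
  under eq_integral do rewrite gee0_abs ?lee_fin -?expr2 ?sqr_ge0 // expr2.
  by rewrite -[LHS]fineK ?integrable_fin_num // -/(Rintegral _ _ _) -/(L2dot mu f f) f0.
move/(ae_eq_integral_abs mu measurableT mff); apply: filterS => z /= /(_ I).
by move=> [/eqP]; rewrite mulf_eq0 orbb => /eqP ->.
Qed.

Lemma ae_eq_sum I (r : seq I) (F G : I -> X -> R) :
  (forall i, F i = G i %[ae mu]) ->
  (fun z => \sum_(i <- r) F i z) = (fun z => \sum_(i <- r) G i z) %[ae mu].
Proof.
move=> FG; elim: r => [|i r IHr]; first by apply: aeW => z _; rewrite !big_nil.
by apply: filterS2 (FG i) IHr => z Fi Fr Iz; rewrite !big_cons Fi // Fr.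
Qed.

Lemma ae_eq_lincomb n (c : 'I_n -> R) (f g : 'I_n -> X -> R) :
  (forall i, f i = g i %[ae mu]) -> lincomb c f = lincomb c g %[ae mu].
Proof.
by move=> fg; apply: ae_eq_sum => i; apply: filterS (fg i) => z + Iz => ->.
Qed.

Lemma lincomb_mulmx m n (B : 'M[R]_(m, n)) (c : 'rV[R]_m) (f : 'I_n -> X -> R) :
  lincomb (c 0) (fun k => lincomb (B k) f) = lincomb ((c *m B) 0) f.
Proof.
apply/funext => z; rewrite /lincomb; under eq_bigr do rewrite mulr_sumr.
rewrite exchange_big /=; apply: eq_bigr => j _; rewrite mxE mulr_suml.
by apply: eq_bigr => i _; rewrite mulrA.
Qed.

(** A span admits repetitions and any number of terms; grouping equal
    generators writes each of its elements with one coefficient per generator. *)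
Lemma L2span_rangeP n (f : 'I_n -> X -> R) g :
  L2span mu (range f) g <->
  g \in L2 /\ exists c : 'rV[R]_n, g = lincomb (c 0) f %[ae mu].
Proof.
split=> [[gL2 [m [c [h [hf gE]]]]]|[gL2 [c gE]]]; split=> //.
  have /choice[k hk] : forall i, exists k, f k = h i.
    by move=> i; have [k _ <-] := hf i; exists k.
  exists (\row_j c j *m \matrix_(i, j) (k i == j)%:R).
  rewrite -lincomb_mulmx; apply: filterS gE => z + Iz => -> //.
  apply: eq_bigr => i _; rewrite mxE -hk; congr (_ * _).
  rewrite /lincomb (bigD1 (k i)) //= mxE eqxx mul1r big1 ?addr0 // => j.
  by rewrite mxE eq_sym => /negPf ->; rewrite mul0r.
by exists n, (c 0), f; split=> // i; exists i.
Qed.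

Lemma L2span_gen (A : set (X -> R)) f : f \in L2 -> A f -> L2span mu A f.
Proof.
move=> fL2 Af; split=> //; exists 1%N, (fun=> 1), (fun=> f); split=> //.
by apply: aeW => z _; rewrite /lincomb big_ord1 mul1r.
Qed.

Lemma L2span_ae_eq (A : set (X -> R)) f g :
  g \in L2 -> g = f %[ae mu] -> L2span mu A f -> L2span mu A g.
Proof.
move=> gL2 gf [fL2 [n [c [h [hA fE]]]]]; split=> //; exists n, c, h; split=> //.
by apply: filterS2 gf fE => z + + Iz => -> // ->.
Qed.

Lemma dot_lincomb n (f : 'I_n -> X -> R) (c c' : 'rV[R]_n) :
  (forall i, f i \in L2) ->
  L2dot mu (lincomb (c 0) f) (lincomb (c' 0) f) =
  (c *m mass_mx mu f *m c'^T) 0 0.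
Proof.
move=> fL2; rewrite L2dot_lincombl //; last exact: Lfun2_lincomb.
rewrite -mulmxA mxE; apply: eq_bigr => i _; congr (_ * _).
rewrite L2dotC L2dot_lincombl // mxE; apply: eq_bigr => j _.
by rewrite !mxE mulrC L2dotC.
Qed.

(** If c L = 0, then the combination of the f with coefficients c has norm 0. *)
Lemma mass_factor_unitmx n (f : 'I_n -> X -> R) (L : 'M[R]_n) :
  (forall i, f i \in L2) -> L2free mu f -> mass_mx mu f = L *m L^T ->
  L \in unitmx.
Proof.
move=> fL2 ffree fE; rewrite -row_free_unit -kermx_eq0; apply/rowV0P => c.
move=> /sub_kermxP cL; apply/rowP => i; rewrite mxE; apply: ffree.
apply: L2dot_eq0; first exact: Lfun2_lincomb.
by rewrite dot_lincomb // fE mulmxA cL !mul0mx mxE.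
Qed.

Lemma L2free_row_free r n (f : 'I_n -> X -> R) (C : 'M[R]_(r, n))
    (w : 'I_r -> X -> R) :
  L2free mu f -> (forall k, w k = lincomb (C k) f %[ae mu]) ->
  L2free mu w <-> row_free C.
Proof.
move=> ffree wE.
have wcE (c : 'rV_r) : lincomb (c 0) w = lincomb ((c *m C) 0) f %[ae mu].
  by rewrite -lincomb_mulmx; exact: ae_eq_lincomb.
split=> [wfree|Cfree c cw0 i].
  rewrite -kermx_eq0; apply/rowV0P => c /sub_kermxP cC; apply/rowP => i.
  rewrite mxE; apply: wfree; apply: filterS (wcE c) => z + Iz => -> //.
  by rewrite cC /lincomb big1 // => j _; rewrite mxE mul0r.
have : (\row_j c j) *m C = 0.
  apply/rowP => j; rewrite [RHS]mxE; apply: ffree.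
  apply: filterS2 (wcE (\row_j c j)) cw0 => z + + Iz => <- // <- //.
  by apply: eq_bigr => k _; rewrite mxE.
move/eqP; rewrite mulmx_free_eq0 // => /eqP/rowP/(_ i).
by rewrite !mxE.
Qed.

End L2_theory.

(** * Tensors on space-time *)

Section tensor_product.
Context {d : measure_display} {Omega : measurableType d} {R : realType}.
Variables (mu : {sigma_finite_measure set Omega -> \bar R}) (T : R).
Let tau := time_measure T.
Let mut := spacetime_measure mu T.
Implicit Types (nu : Omega -> R) (psi : R -> R).

Lemma measurable_tensor nu psi :
  measurable_fun setT nu -> measurable_fun setT (psi : measurableTypeR R -> R) ->
  measurable_fun setT (tensor nu psi).
Proof.
move=> mnu mpsi; apply: measurable_funM.
- exact: measurableT_comp mnu measurable_fst.
- exact: measurableT_comp mpsi measurable_snd.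
Qed.

Lemma Lfun2_tensor nu psi :
  nu \in Lfun mu 2%:E -> psi \in Lfun tau 2%:E -> tensor nu psi \in Lfun mut 2%:E.
Proof.
move=> /Lfun2P[mnu inu] /Lfun2P[mpsi ipsi]; apply/Lfun2P.
have mt := measurable_tensor mnu mpsi; split=> //.
rewrite fubini_tonelli1 /=; last 2 first.
- by apply/measurable_EFinP; exact: measurable_funX.
- by move=> z; rewrite lee_fin sqr_ge0.
rewrite /fubini_F /=.
under eq_integral => x _.
  rewrite (_ : (fun y => _) =
      (fun y => ((nu x ^+ 2)%:E * (psi y ^+ 2)%:E)%E)); last first.
    by apply/funext => y; rewrite /tensor /= exprMn EFinM.
  rewrite ge0_integralZl //; last 3 first.
  - by apply/measurable_EFinP; exact: measurable_funX.
  - by move=> y _; rewrite lee_fin sqr_ge0.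
  - by rewrite lee_fin sqr_ge0.
  over.
rewrite ge0_integralZr //; last 3 first.
- by apply/measurable_EFinP; exact: measurable_funX.
- by move=> y _; rewrite lee_fin sqr_ge0.
- by apply: integral_ge0 => y _; rewrite lee_fin sqr_ge0.
have inu0 : (0 <= \int[mu]_x (nu x ^+ 2)%:E)%E.
  by apply: integral_ge0 => y _; rewrite lee_fin sqr_ge0.
by apply: lte_mul_pinfty => //; rewrite ge0_fin_numE.
Qed.

(** Fubini applies because products of square integrable functions are
    integrable. *)
Lemma L2dot_tensor nu nu' psi psi' :
  nu \in Lfun mu 2%:E -> nu' \in Lfun mu 2%:E ->
  psi \in Lfun tau 2%:E -> psi' \in Lfun tau 2%:E ->
  L2dot mut (tensor nu psi) (tensor nu' psi') =
  L2dot mu nu nu' * L2dot tau psi psi'.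
Proof.
move=> nuL nu'L psiL psi'L.
have inu := integrable_mul_Lfun2 nuL nu'L.
have ipsi := integrable_mul_Lfun2 psiL psi'L.
have it := integrable_mul_Lfun2 (Lfun2_tensor nuL psiL) (Lfun2_tensor nu'L psi'L).
rewrite /L2dot /Rintegral -fineM ?integrable_fin_num //; congr fine.
rewrite -(integral12_prod_meas1 it) /fubini_F /=.
under eq_integral => x _.
  rewrite (_ : (fun y => _) =
      (fun y => ((nu x * nu' x)%:E * (psi y * psi' y)%:E)%E)); last first.
    by apply/funext => y; rewrite /tensor /= mulrACA EFinM.
  rewrite integralZl //.
  over.
have := integrable_fin_num measurableT ipsi.
by move: (integral _ _ _) => [r| |] // _; exact: integralZr.
Qed.

(** The exceptional points lie in the cylinders over the two exceptional null
    sets, and such cylinders have product measure 0, even over a space of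
    infinite measure. *)
Lemma ae_eq_tensor nu nu' psi psi' :
  nu = nu' %[ae mu] -> psi = psi' %[ae tau] ->
  tensor nu psi = tensor nu' psi' %[ae mut].
Proof.
move=> [N [mN N0 subN]] [M [mM M0 subM]].
exists ((N `*` setT) `|` (setT `*` M)); split.
- by apply: measurableU; apply: measurableX.
- have NT : mut (N `*` setT) = (mu N * tau setT)%E by exact: product_measure1E.
  have TM : mut (setT `*` M) = (mu setT * tau M)%E by exact: product_measure1E.
  apply/eqP; rewrite -measure_le0.
  apply: le_trans (measureU2 _ _ _) _; [exact: measurableX..|].
  by rewrite [X in (X + _)%E]NT [X in (_ + X)%E]TM N0 M0 mule0 mul0e adde0.
- move=> [x y] /= /not_implyP[_ neq].
  have [Nx|nNx] := pselect (N x); [by left|right; split=> //].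
  apply: contrapT => nMy; apply: neq; rewrite /tensor /=; congr (_ * _).
  + by apply: contrapT => nxx; apply/nNx/subN => /(_ I).
  + by apply: contrapT => nyy; apply/nMy/subM => /(_ I).
Qed.

End tensor_product.

(** * The error of the projection onto W . Y *)

Section tensor_comb.
Context {d : measure_display} {Omega : measurableType d} {R : realType}.
Variables (mu : {sigma_finite_measure set Omega -> \bar R}) (T : R).
Variables (s q : nat) (psi : 'I_s -> R -> R) (nu : 'I_q -> Omega -> R).
Let tau := time_measure T.
Let mut := spacetime_measure mu T.
Hypotheses (psiL2 : forall j, psi j \in Lfun tau 2%:E)
  (nuL2 : forall i, nu i \in Lfun mu 2%:E).
Implicit Types (Z : 'M[R]_(q, s)).

Definition tensor_comb Z : Omega * measurableTypeR R -> R :=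
  fun z => \sum_(j < s) \sum_(i < q) Z i j * tensor (nu i) (psi j) z.

Lemma tensor_combB Z Z' :
  tensor_comb Z \- tensor_comb Z' = tensor_comb (Z - Z').
Proof.
apply/funext => z; rewrite /tensor_comb /= -sumrB; apply: eq_bigr => j _.
by rewrite -sumrB; apply: eq_bigr => i _; rewrite !mxE mulrBl.
Qed.

Lemma tensor_comb_sum n (c : 'I_n -> R) (Z : 'I_n -> 'M[R]_(q, s)) :
  lincomb c (fun k => tensor_comb (Z k)) = tensor_comb (\sum_k c k *: Z k).
Proof.
apply/funext => z; rewrite /lincomb /tensor_comb.
under eq_bigr do rewrite mulr_sumr.
rewrite exchange_big /=; apply: eq_bigr => j _.
under eq_bigr do rewrite mulr_sumr.
rewrite exchange_big /=; apply: eq_bigr => i _; rewrite summxE mulr_suml.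
by apply: eq_bigr => k _; rewrite mxE mulrA.
Qed.

Lemma tensor_lincomb (a : 'rV[R]_q) (b : 'rV[R]_s) :
  tensor (lincomb (a 0) nu) (lincomb (b 0) psi) = tensor_comb (a^T *m b).
Proof.
apply/funext => z; rewrite /tensor /tensor_comb /lincomb mulr_sumr.
apply: eq_bigr => j _; rewrite mulr_suml; apply: eq_bigr => i _.
by rewrite mxE big_ord1 mxE mulrACA.
Qed.

Lemma Lfun2_tensor_comb Z : tensor_comb Z \in Lfun mut 2%:E.
Proof.
apply: Lfun2_sum => j; apply: Lfun2_sum => i; apply: Lfun2Z.
exact: Lfun2_tensor.
Qed.

(** The factors of the mass matrices turn coefficients into coordinates in
    orthonormal bases, in which the space-time inner product is that of
    Frobenius. *)
Lemma dot_tensor_comb (L_Y : 'M[R]_q) (L_S : 'M[R]_s) Z Z' :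
  mass_mx mu nu = L_Y *m L_Y^T -> mass_mx tau psi = L_S *m L_S^T ->
  L2dot mut (tensor_comb Z) (tensor_comb Z') =
  \tr ((L_Y^T *m Z *m L_S) *m (L_Y^T *m Z' *m L_S)^T).
Proof.
move=> hMY hMS.
have tL2 i j : tensor (nu i) (psi j) \in Lfun mut 2%:E by exact: Lfun2_tensor.
have -> : \tr ((L_Y^T *m Z *m L_S) *m (L_Y^T *m Z' *m L_S)^T) =
    \tr (Z *m (mass_mx mu nu *m Z' *m mass_mx tau psi)^T).
  rewrite hMY hMS !trmx_mul !trmxK !mulmxA -!mulmxA mxtrace_mulC.
  by rewrite -!mulmxA.
have dotl i j : L2dot mut (tensor (nu i) (psi j)) (tensor_comb Z') =
    (mass_mx mu nu *m Z' *m mass_mx tau psi) i j.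
  rewrite L2dotC L2dot_suml // => [|k]; last first.
    by apply: Lfun2_sum => l; exact: Lfun2Z.
  rewrite mxE; apply: eq_bigr => k _.
  rewrite L2dot_suml // => [|l]; last exact: Lfun2Z.
  rewrite mxE mulr_suml; apply: eq_bigr => l _; rewrite L2dotZl //.
  rewrite L2dot_tensor // !mxE (L2dotC mu (nu i)).
  by rewrite mulrA (mulrC (Z' l k)).
rewrite L2dot_suml; [|by move=> j; apply: Lfun2_sum => i; exact: Lfun2Z|
  exact: Lfun2_tensor_comb].
rewrite mxtrace_mul_tr exchange_big /=; apply: eq_bigr => j _.
rewrite L2dot_suml; [|by move=> i; exact: Lfun2Z|exact: Lfun2_tensor_comb].
apply: eq_bigr => i _; rewrite L2dotZl ?dotl //; exact: Lfun2_tensor_comb.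
Qed.

(** In the coefficients B C, column k of B gives the spatial factor that
    multiplies w k. *)
Lemma prod_subspaceP r (W : set (R -> R)) (w : 'I_r -> R -> R)
    (C : 'M[R]_(r, s)) (v : Omega * measurableTypeR R -> R) :
  L2basis tau w W -> (forall k, w k = lincomb (C k) psi %[ae tau]) ->
  prod_subspace mu T W (L2span mu (range nu)) v <->
  v \in Lfun mut 2%:E /\
  exists B : 'M[R]_(q, r), v = tensor_comb (B *m C) %[ae mut].
Proof.
move=> [wL2 _ ->] wE; split=> [[vL2 [n [c [h [hW vE]]]]]|[vL2 [B vE]]].
  split=> //.
  have /choice[D hD] : forall i, exists D : 'M[R]_(q, r),
      h i = tensor_comb (D *m C) %[ae mut].
    move=> i; have [nu' [w' [/L2span_rangeP[_ [a aE]] ]]] := hW i.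
    move=> /L2span_rangeP[_ [b bE]] ->; exists (a^T *m b).
    rewrite -mulmxA -tensor_lincomb; apply: ae_eq_tensor => //.
    rewrite -lincomb_mulmx; have := ae_eq_lincomb (b 0) wE.
    by apply: filterS2 bE => z + + Iz => -> // ->.
  exists (\sum_k c k *: D k); rewrite mulmx_suml.
  under eq_bigr do rewrite -scalemxAl.
  rewrite -tensor_comb_sum; have := ae_eq_lincomb c hD.
  by apply: filterS2 vE => z + + Iz => -> // ->.
split=> //.
exists r, (fun=> 1), (fun k => tensor (lincomb (fun i => B i k) nu)
  (lincomb (C k) psi)); split=> [k|].
  exists (lincomb (fun i => B i k) nu), (lincomb (C k) psi); split=> //.
    apply/L2span_rangeP; split; first exact: Lfun2_lincomb.
    by exists (\row_i B i k); apply: aeW => z _; apply: eq_bigr => i _; rewrite mxE.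
  have lL2 : lincomb (C k) psi \in Lfun tau 2%:E by exact: Lfun2_lincomb.
  have wk : L2span tau (range w) (w k) by apply: L2span_gen => //; exists k.
  by apply: L2span_ae_eq lL2 _ wk; exact: ae_eq_sym (wE k).
apply: filterS vE => z + Iz => -> //.
rewrite (_ : (fun k => _) =
    (fun k => tensor_comb ((\row_i B i k)^T *m row k C))).
  rewrite tensor_comb_sum; congr (tensor_comb _ z).
  apply/matrixP => i j; rewrite summxE mxE; apply: eq_bigr => k _.
  by rewrite !mxE big_ord1 !mxE mul1r.
apply/funext => k; rewrite -tensor_lincomb; congr tensor.
  by congr lincomb; apply/funext => i; rewrite mxE.
by congr lincomb; apply/funext => i; rewrite mxE.
Qed.

(** In orthonormal coordinates the matrix of x is A = L_Y^T X L_S and the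
    elements of W . Y are the matrices whose rows lie in the row space of
    C L_S; the projection of x is therefore A (row_proj (C L_S)). *)
Lemma proj_error r (W : set (R -> R)) (w : 'I_r -> R -> R) (C : 'M[R]_(r, s))
    (L_Y : 'M[R]_q) (L_S : 'M[R]_s) (x : Omega * measurableTypeR R -> R)
    (X : 'M[R]_(q, s)) :
  mass_mx mu nu = L_Y *m L_Y^T -> mass_mx tau psi = L_S *m L_S^T ->
  L_Y \in unitmx -> row_free (C *m L_S) ->
  L2basis tau w W -> (forall k, w k = lincomb (C k) psi %[ae tau]) ->
  x \in Lfun mut 2%:E -> x = tensor_comb X %[ae mut] ->
  let A := L_Y^T *m X *m L_S in
  L2norm mut
    (x \- orth_proj mut (prod_subspace mu T W (L2span mu (range nu))) x) =
  Num.sqrt (\tr (A *m A^T) - \tr (A *m row_proj (C *m L_S) *m A^T)).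
Proof.
move=> hMY hMS LYu Ctfree wW wE xL2 xE A; set Ct := C *m L_S in Ctfree *.
set V := prod_subspace _ _ _ _.
have VP v : V v <-> v \in Lfun mut 2%:E /\
    exists B : 'M[R]_(q, r), v = tensor_comb (B *m C) %[ae mut].
  exact: prod_subspaceP wW wE.
have combL2 := Lfun2_tensor_comb.
have CtE (B : 'M[R]_(q, r)) : L_Y^T *m (B *m C) *m L_S = L_Y^T *m B *m Ct.
  by rewrite /Ct !mulmxA.
have dotE p v B B' :
    p \in Lfun mut 2%:E -> p = tensor_comb (B *m C) %[ae mut] ->
    v \in Lfun mut 2%:E -> v = tensor_comb B' %[ae mut] ->
    L2dot mut (x \- p) v =
    \tr ((A - L_Y^T *m B *m Ct) *m (L_Y^T *m B' *m L_S)^T).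
  move=> pL2 pE vL2 vE.
  have rE : x \- p = tensor_comb (X - B *m C) %[ae mut].
    rewrite -tensor_combB.
    by apply: filterS2 xE pE => z + + Iz /= => -> // ->.
  rewrite (ae_eq_L2dot _ _ vL2 (combL2 B') rE vE) //; last exact: Lfun2B.
  by rewrite (dot_tensor_comb _ _ hMY hMS) mulmxBr mulmxBl CtE.
have LYTu : L_Y^T \in unitmx by rewrite unitmx_tr.
have [p pE] : exists p, is_orth_proj mut V x p.
  (* chosen so that the orthonormal coordinates of B C are A (row_proj Ct) *)
  pose B := invmx L_Y^T *m (A *m Ct^T *m invmx (Ct *m Ct^T)).
  have BE : L_Y^T *m B *m Ct = A *m row_proj Ct.
    by rewrite /B mulKVmx // /row_proj !mulmxA.
  exists (tensor_comb (B *m C)); split.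
    by apply/VP; split=> //; exists B; exact: aeW.
  move=> v /VP[vL2 [B' vE]]; rewrite (dotE _ _ B _ _ _ vL2 vE) //; last exact: aeW.
  by rewrite BE CtE trmx_mul mulmxA mul_sub_row_proj // mul0mx mxtrace0.
have [/VP[p'L2 [B p'E]] orth] := xgetPex (cst 0) (ex_intro _ p pE).
rewrite -/(orth_proj mut V x) in p'L2 p'E orth *.
rewrite /L2norm; congr Num.sqrt.
have resE : x \- orth_proj mut V x = tensor_comb (X - B *m C) %[ae mut].
  rewrite -tensor_combB.
  by apply: filterS2 xE p'E => z + + Iz /= => -> // ->.
rewrite (dotE _ _ B _ _ _ _ resE) //; last exact: Lfun2B.
have -> : L_Y^T *m (X - B *m C) *m L_S = A - L_Y^T *m B *m Ct.
  by rewrite mulmxBr mulmxBl CtE.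
apply: orth_residual_norm => // B'.
(* every B' C L_S is the coordinate matrix of some element of V *)
pose B1 := invmx L_Y^T *m B'.
rewrite -[RHS](orth (tensor_comb (B1 *m C))); last first.
  by apply/VP; split=> //; exists B1; exact: aeW.
rewrite (dotE _ _ B (B1 *m C)) //; last exact: aeW.
by rewrite CtE /B1 mulKVmx.
Qed.

End tensor_comb.

(** * Optimality of the leading right singular vectors *)

Theorem lemma2p6 (R : realType) (T : R) (hT : 0 < T)
    (d : measure_display) (Omega : measurableType d)
    (mu : {sigma_finite_measure set Omega -> \bar R})
    (s q : nat) (psi : 'I_s -> R -> R) (nu : 'I_q -> Omega -> R)
    (calS : set (R -> R)) (calY : set (Omega -> R))
    (hS : L2basis (time_measure T) psi calS)
    (hY : L2basis mu nu calY)
    (L_Y : 'M[R]_q) (L_S : 'M[R]_s)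
    (hMY : mass_mx mu nu = L_Y *m L_Y^T)
    (hMS : mass_mx (time_measure T) psi = L_S *m L_S^T)
    (x : Omega * R -> R) (X : 'M[R]_(q, s))
    (hx : prod_subspace mu T calS calY x)
    (hX : x = (fun z => \sum_(j < s) \sum_(i < q)
                          X i j * tensor (nu i) (psi j) z)
            %[ae spacetime_measure mu T])
    (shat : nat) (hshat1 : (1 <= shat)%N) (hshat : (shat <= s)%N)
    (U : 'M[R]_(s, shat))
    (hU : leading_right_singular_vectors hshat (L_Y^T *m X *m L_S) U) :
  let psihat (j : 'I_shat) :=
    lincomb (fun k : 'I_s => (U^T *m invmx L_S) j k) psi in
  let calShat := L2span (time_measure T) (range psihat) in
  let err (W : set (R -> R)) :=
    L2norm (spacetime_measure mu T)
      (x \- orth_proj (spacetime_measure mu T) (prod_subspace mu T W calY) x) in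
  [/\ calShat `<=` calS, L2subspace_dim (time_measure T) calShat shat
    & forall W : set (R -> R), W `<=` calS ->
        L2subspace_dim (time_measure T) W shat -> err calShat <= err W].
Proof.
move=> psihat calShat err.
have [psiL2 psifree calSE] := hS; have [nuL2 nufree calYE] := hY.
have LSu := mass_factor_unitmx psiL2 psifree hMS.
have LYu := mass_factor_unitmx nuL2 nufree hMY.
have xL2 : x \in Lfun (spacetime_measure mu T) 2%:E by case: hx.
have UU := leading_right_singular_vectors_orth hU.
set A := L_Y^T *m X *m L_S in hU.
pose Chat := U^T *m invmx L_S.
have ChatE : Chat *m L_S = U^T by rewrite /Chat mulmxKV.
have Chatfree : row_free Chat.
  apply/row_freeP; exists (L_S *m U); by rewrite mulmxA ChatE.
have hatL2 k : psihat k \in Lfun (time_measure T) 2%:E by exact: Lfun2_lincomb.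
have hatE k : psihat k = lincomb (Chat k) psi %[ae time_measure T] by exact: aeW.
have hatbasis : L2basis (time_measure T) psihat calShat.
  by split=> //; apply/(L2free_row_free psifree hatE).
split; last 1 first.
- move=> W WS [w wW]; have [wL2 wfree WE] := wW.
  have /choice[C' wE'] : forall k, exists c : 'rV[R]_s,
      w k = lincomb (c 0) psi %[ae time_measure T].
    move=> k; suff : calS (w k) by rewrite calSE => /L2span_rangeP[].
    by apply: WS; rewrite WE; apply: L2span_gen => //; exists k.
  pose C := \matrix_(k, j) C' k 0 j.
  have wE k : w k = lincomb (C k) psi %[ae time_measure T].
    apply: filterS (wE' k) => z + Iz => -> //.
    by apply: eq_bigr => j _; rewrite mxE.
  have Cfree : row_free (C *m L_S).
    rewrite /row_free mxrankMfree ?row_free_unit // -/(row_free C).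
    exact/(L2free_row_free psifree wE).
  rewrite /err calYE.
  rewrite (proj_error psiL2 nuL2 hMY hMS LYu _ hatbasis hatE xL2 hX); last first.
    by rewrite ChatE; apply/row_freeP; exists U.
  rewrite (proj_error psiL2 nuL2 hMY hMS LYu Cfree wW wE xL2 hX).
  apply: ler_wsqrtr; rewrite lerD2l lerN2 -/A ChatE.
  rewrite [in leRHS]/row_proj trmxK UU invmx1 mulmx1.
  apply: energy_le_leading => //.
  + exact: row_proj_tr.
  + exact: row_proj_idem.
  + exact: mxtrace_row_proj.
- move=> g; rewrite calSE => /L2span_rangeP[gL2 [c gE]].
  apply/L2span_rangeP; split=> //; exists (c *m Chat).
  by rewrite -lincomb_mulmx.
- by exists psihat.
Qed.
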